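(* Let $\Pi$ be the Hamming-distance conditional encryption construction described in the context, with message space $\Sigma^n$ and predicate $P_{\ell,\mathsf{Ham}}$, where $P_{\ell,\mathsf{Ham}}(m_1,m_2)=1$ if and only if $\mathsf{Ham}(m_1,m_2)\le\ell$. Then $\Pi$ is a $1-\epsilon(\lambda)$-correct and $1-\epsilon(\lambda)$-error detecting conditional encryption scheme with $$\epsilon(\lambda)=\binom{n}{\ell}\epsilon_{AE}(\lambda)+2^{-\lambda},$$ where $$\epsilon_{AE}(\lambda)=\max_m\Pr_{K_1,K_2\in\{0,1\}^\lambda}\left[\mathsf{Auth.Dec}_{K_1}(\mathsf{Auth.Enc}_{K_2}(m))\ne\bot\right]$$ denotes the probability that a ciphertext $\mathsf{Auth.Enc}_{K_2}(m)$ is still valid under an unrelated key $K_1$.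
   Context: **Conditional encryption.** For a binary predicate $P:\mathcal M\times\mathcal M\to\{0,1\}$, a conditional encryption scheme consists of algorithms $(\mathsf{KeyGen},\mathsf{Enc},\mathsf{CondEnc},\mathsf{Dec})$: $(sk,pk)=\mathsf{KeyGen}(1^\lambda;r)$; $\mathsf{Enc}_{pk}(m_1;r)$ outputs a ciphertext with flag $0$; $\mathsf{CondEnc}_{pk}(c,m_2,m_3;r)$ takes a regular (flag $0$) ciphertext, a control message $m_2$ and a payload message $m_3$ and outputs a ciphertext with flag $1$ (and outputs $\bot$ if the input ciphertext has flag $1$); $\mathsf{Dec}_{sk}$ outputs a message in $\mathcal M$ or $\bot$. *Correctness.* The scheme is $1-\epsilon(\cdot)$-correct if (i) for all coins $r_1,r_2$ and $m\in\mathcal M$, with $(sk,pk)=\mathsf{KeyGen}(1^\lambda;r_1)$, $\mathsf{Dec}_{sk}(\mathsf{Enc}_{pk}(m;r_2))=m$; and (ii) for all $r_1,r_2$ and all $m_1,m_2,m_3\in\mathcal M$ with $P(m_1,m_2)=1$, $\Pr_{r_3}[\mathsf{Dec}_{sk}(\mathsf{CondEnc}_{pk}(\mathsf{Enc}_{pk}(m_1;r_2),m_2,m_3;r_3))=m_3]\ge 1-\epsilon(\lambda)$. *Error detection.* The scheme is $1-\epsilon(\cdot)$-error detecting if for all $r_1,r_2$ and all $m_1,m_2,m_3\in\mathcal M$ with $P(m_1,m_2)=0$, with $(sk,pk)=\mathsf{KeyGen}(1^\lambda;r_1)$, $\Pr_{r_3}[\mathsf{Dec}_{sk}(\mathsf{CondEnc}_{pk}(\mathsf{Enc}_{pk}(m_1;r_2),m_2,m_3;r_3))=\bot]\ge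 1-\epsilon(\lambda)$. **Paillier.** Public key $(N,g)$, $N=pq$ with $p,q$ distinct primes, $\gcd(N,(p-1)(q-1))=1$, $g=N+1$; encryption of $m\in\mathbb Z_N$ with nonce $r\in\mathbb Z_N^*$: $\mathsf{P.Enc}_{pk}(m;r)=g^mr^N\bmod N^2$; decryption $\mathsf{P.Dec}_{sk}(c)$ of $c\in\mathbb Z_{N^2}^*$ returns the unique $m\in\mathbb Z_N$ such that $c=g^mr^N\bmod N^2$ for some $r\in\mathbb Z_N^*$, computed from the factorization of $N$. **Secret sharing.** $\mathsf{ShareGen}(n,t,s)$ is Shamir secret sharing over the field $\mathbb F_{2^\lambda}$ ($n+1\le 2^\lambda$), producing shares $s_1,\dots,s_n\in\mathbb F_{2^\lambda}$ (identified with integers in $\{0,\dots,2^\lambda-1\}$): $s_i=\phi(x_i)$ for a random polynomial $\phi$ of degree at most $t-1$ with $\phi(x_0)=s$, where $x_0,\dots,x_n$ are fixed distinct field elements. $\mathsf{SecretRecover}$ on $t$ indexed shares interpolates and returns the value at $x_0$. **Authenticated encryption.** A symmetric-key scheme $(\mathsf{Auth.Enc},\mathsf{Auth.Dec})$ with keys in $\{0,1\}^\lambda$ and $\mathsf{Auth.Dec}_K(\mathsf{Auth.Enc}_K(m))=m$; $\mathsf{Auth.Dec}$ returns a message or $\bot$. **The Hamming construction.** $\Sigma$ is a finite alphabet, $m[i]$ is the $i$th character of $m\in\Sigma^n$, $\mathsf{Ham}(m_1,m_2)=|\{i:m_1[i]\ne m_2[i]\}|$, $0\le\ell<n$. $\mathsf{ToInt}:\Sigma\to\{0,\dots,|\Sigma|-1\}$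 is a bijection. - $\mathsf{KeyGen}$: Paillier key generation with $\min\{p,q\}\ge|\Sigma|$, $\gcd(N,(p-1)(q-1))=1$ and $N\ge 2n2^{2\lambda}$. - $\mathsf{Enc}_{pk}(m)=(0,c[1],\dots,c[n])$ with $c[i]=\mathsf{P.Enc}_{pk}(\mathsf{ToInt}(m[i]);r_i)$, independent uniform $r_i\in\mathbb Z_N^*$. - $\mathsf{CondEnc}_{pk}((b,c_1[1],\dots,c_1[n]),m_2,m_3)$: if $b=1$ output $\bot$. Otherwise pick uniform $K\in\{0,1\}^\lambda$, compute $c_{AE}=\mathsf{Auth.Enc}_K(m_3)$ and shares $(s_1,\dots,s_n)\leftarrow\mathsf{ShareGen}(n,n-\ell,K)$. For each $i$ let $x_i=\mathsf{REnc}(s_i)=a_i2^\lambda+s_i$ with $a_i$ uniform in $\{0,\dots,\lfloor (N-1-s_i)/2^\lambda\rfloor\}$, pick uniform $R_i\in\mathbb Z_N$, $r_i\in\mathbb Z_N^*$, and set $c[i]=c_1[i]^{R_i}(N+1)^{-R_i\mathsf{ToInt}(m_2[i])+x_i}r_i^N\bmod N^2$. Output $(1,c[1],\dots,c[n],c_{AE})$. - $\mathsf{Dec}_{sk}$: for flag $0$, decrypt character by character and apply $\mathsf{ToInt}^{-1}$. For flag $1$, compute $s_i'=\mathsf{P.Dec}_{sk}(c[i])\bmod 2^\lambda$; go through all $S\subseteq[n]$ with $|S|=n-\ell$, compute $K_S=\mathsf{SecretRecover}(\{(i,s_i')\}_{i\in S})$ and, if $\mathsf{Auth.Dec}_{K_S}(c_{AE})\ne\bot$,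 return this value; if all subsets fail return $\bot$. *)

(* Defs.v *)
From HB Require Import structures.
From mathcomp Require Import all_boot all_order all_fingroup all_algebra.
Set Implicit Arguments.
Unset Strict Implicit.
Unset Printing Implicit Defensive.

Import Order.TTheory GRing.Theory Num.Theory.
Local Open Scope ring_scope.

(* A randomized algorithm draws finitely many uniform samples, each from a
   finite type that may depend on the samples drawn before.  The element [x0]
   in [Draw] only witnesses that the type sampled from is nonempty. *)
Inductive rnd (A : Type) : Type :=
| Ret of A
| Draw (T : finType) (x0 : T) (k : T -> rnd A).

Definition unif (T : finType) (x0 : T) : rnd T := Draw x0 (@Ret T).

Fixpoint bind (A B : Type) (t : rnd A) (f : A -> rnd B) : rnd B :=
  match t with
  | Ret a => f a
  | Draw T x0 k => Draw x0 (fun x => bind (k x) f)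
  end.

Notation "x <-$ t ;; u" := (bind t (fun x => u))
  (at level 100, t at next level, right associativity).

Fixpoint Pr (R : realFieldType) (A : Type) (t : rnd A) (E : A -> bool) : R :=
  match t with
  | Ret a => (E a)%:R
  | Draw T _ k => (\sum_(x : T) Pr R (k x) E) / #|T|%:R
  end.

Fixpoint always (A : Type) (t : rnd A) (Q : A -> Prop) : Prop :=
  match t with
  | Ret a => Q a
  | Draw T _ k => forall x : T, always (k x) Q
  end.

(* A scheme at one value of the security parameter; [None] is the failure
   symbol. *)
Record cond_enc (M : eqType) := CondEnc {
  ce_kcoins : Type;
  ce_sk : Type;
  ce_pk : Type;
  ce_keygen : ce_kcoins -> ce_sk * ce_pk;
  ce_ctxt : ce_pk -> Type;
  ce_flag : forall pk, ce_ctxt pk -> bool;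
  ce_ecoins : ce_pk -> finType;
  ce_enc : forall pk, M -> ce_ecoins pk -> ce_ctxt pk;
  ce_condenc : forall pk, ce_ctxt pk -> M -> M -> rnd (option (ce_ctxt pk));
  ce_dec : forall pk, ce_sk -> ce_ctxt pk -> option M;
  ce_enc_flag : forall pk m r, ce_flag (@ce_enc pk m r) = false;
  ce_condenc_flag0 : forall pk c m2 m3, ce_flag c = false ->
    always (@ce_condenc pk c m2 m3)
      (fun o => if o is Some c' then ce_flag c' = true else False);
  ce_condenc_flag1 : forall pk c m2 m3, ce_flag c = true ->
    @ce_condenc pk c m2 m3 = Ret None
}.

Section Properties.
Variables (R : realFieldType) (M : eqType) (P : rel M).

(* The only randomness is that of CondEnc: the coins [r1] of KeyGen and [r2] of
   Enc are fixed. *)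
Definition dec_condenc (Pi : cond_enc M) (r1 : ce_kcoins Pi) (m1 : M)
    (r2 : ce_ecoins (ce_keygen r1).2) (m2 m3 : M) : rnd (option M) :=
  let: sk := (ce_keygen r1).1 in
  c <-$ ce_condenc (ce_enc m1 r2) m2 m3 ;;
  Ret (obind (ce_dec sk) c).

(* [L] is the set of admissible security parameters. *)
Definition correct (L : pred nat) (Pi : forall lambda, L lambda -> cond_enc M)
    (eps : nat -> R) : Prop :=
  forall (lambda : nat) (hL : L lambda),
  [/\ forall (r1 : ce_kcoins (Pi lambda hL))
             (r2 : ce_ecoins (ce_keygen r1).2) (m : M),
        ce_dec (ce_keygen r1).1 (ce_enc m r2) = Some m
    & forall (r1 : ce_kcoins (Pi lambda hL))
             (r2 : ce_ecoins (ce_keygen r1).2) (m1 m2 m3 : M),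
        P m1 m2 ->
        Pr R (dec_condenc m1 r2 m2 m3) (fun o => o == Some m3)
          >= 1 - eps lambda].

Definition error_detecting (L : pred nat)
    (Pi : forall lambda, L lambda -> cond_enc M) (eps : nat -> R) : Prop :=
  forall (lambda : nat) (hL : L lambda) (r1 : ce_kcoins (Pi lambda hL))
         (r2 : ce_ecoins (ce_keygen r1).2) (m1 m2 m3 : M),
    ~~ P m1 m2 ->
    Pr R (dec_condenc m1 r2 m2 m3) (fun o => o == None) >= 1 - eps lambda.

End Properties.

Definition key (lambda : nat) : finType := lambda.-tuple bool.

Definition unif_key (lambda : nat) : rnd (key lambda) :=
  unif (nseq_tuple lambda false : key lambda).

Record auth_enc (lambda : nat) (M : finType) := AuthEnc {
  ae_ctxt : Type;
  ae_enc : key lambda -> M -> rnd ae_ctxt;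
  ae_dec : key lambda -> ae_ctxt -> option M;
  ae_encK : forall K m, always (ae_enc K m) (fun c => ae_dec K c = Some m)
}.

Definition eps_AE (R : realFieldType) (lambda : nat) (M : finType)
    (AE : auth_enc lambda M) : R :=
  \big[Num.max/0]_(m : M)
    Pr R (K1 <-$ unif_key lambda ;;
          K2 <-$ unif_key lambda ;;
          c <-$ ae_enc AE K2 m ;;
          Ret (ae_dec K1 c))
       (fun o => o != None).

(* The field comes with the identification of its elements with
   {0, ..., 2 ^ lambda - 1} (so that #|sf_field| = 2 ^ lambda) and with
   {0,1} ^ lambda.  [sf_pt ord0] is the point carrying the secret and
   [sf_pt (lift ord0 i)] is the point of the share with index [i : 'I_n]. *)
Record shamir_field (lambda n : nat) := ShamirField {
  sf_field : finFieldType;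
  sf_to_nat : sf_field -> 'I_(2 ^ lambda);
  sf_of_nat : 'I_(2 ^ lambda) -> sf_field;
  sf_to_natK : cancel sf_to_nat sf_of_nat;
  sf_of_natK : cancel sf_of_nat sf_to_nat;
  sf_to_key : sf_field -> key lambda;
  sf_of_key : key lambda -> sf_field;
  sf_to_keyK : cancel sf_to_key sf_of_key;
  sf_of_keyK : cancel sf_of_key sf_to_key;
  sf_pt : 'I_n.+1 -> sf_field;
  sf_pt_inj : injective sf_pt
}.

Section Shamir.
Variables (F : finFieldType) (n : nat) (x : 'I_n.+1 -> F).

Definition sharing_poly (t : nat) (s : F) : finType :=
  {phi : {poly_t F} | (phi : {poly F}).[x ord0] == s}.

Fact const_sharing_poly_subproof (t : nat) (s : F) : (0 < t)%N ->
  (npolyp t s%:P : {poly F}).[x ord0] == s.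
Proof.
by move=> t0; rewrite npolypK ?hornerC // (leq_trans (size_polyC_leq1 _)).
Qed.

Definition const_sharing_poly (t : nat) (ht : (0 < t)%N) (s : F) :
    sharing_poly t s :=
  exist _ (npolyp t s%:P) (const_sharing_poly_subproof s ht).

Definition share_gen (t : nat) (ht : (0 < t)%N) (s : F) :
    rnd {ffun 'I_n -> F} :=
  phi <-$ unif (const_sharing_poly ht s) ;;
  Ret [ffun i => (val phi : {poly F}).[x (lift ord0 i)]].

(* Lagrange interpolation of the shares indexed by [S], evaluated at [x ord0]. *)
Definition secret_recover (S : {set 'I_n}) (y : {ffun 'I_n -> F}) : F :=
  let pt i := x (lift ord0 i) in
  (\sum_(i in S) y i *: \prod_(j in S :\ i)
     ((pt i - pt j)^-1 *: ('X - (pt j)%:P))).[x ord0].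

End Shamir.

Section Paillier.
Variable N : nat.

(* The generator is g = N + 1, so that N alone is the public key. *)
Definition p_enc (m : 'Z_N) (r : {unit 'Z_N}) : 'Z_(N ^ 2) :=
  N.+1%:R ^+ m * (val r : nat)%:R ^+ N.

(* As a function, decryption depends on [N] only: the factorization of [N] is
   what makes it efficiently computable. *)
Definition p_dec (c : 'Z_(N ^ 2)) : option 'Z_N :=
  [pick m : 'Z_N | [exists r : {unit 'Z_N}, c == p_enc m r]].

End Paillier.

(* Nothing is assumed about the distribution of the primes: correctness and
   error detection are required for all coins of the key generation. *)
Record paillier_keygen (sigma n lambda : nat) := PaillierKeygen {
  pk_coins : Type;
  pk_p : pk_coins -> nat;
  pk_q : pk_coins -> nat;
  pk_p_prime : forall r, prime (pk_p r);
  pk_q_prime : forall r, prime (pk_q r);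
  pk_pq_neq : forall r, pk_p r != pk_q r;
  pk_coprime : forall r,
    coprime (pk_p r * pk_q r) ((pk_p r).-1 * (pk_q r).-1);
  pk_min : forall r, (sigma <= minn (pk_p r) (pk_q r))%N;
  pk_large : forall r, (2 * n * 2 ^ (2 * lambda) <= pk_p r * pk_q r)%N
}.

Section Hamming.
Variables (Sigma : finType) (n : nat).

Definition message : finType := {ffun 'I_n -> Sigma}.

Definition Ham (m1 m2 : message) : nat := #|[set i | m1 i != m2 i]|.

Definition P_Ham (l : nat) : rel message := fun m1 m2 => (Ham m1 m2 <= l)%N.

Variables (l : nat) (hl : (l < n)%N) (toInt : Sigma -> 'I_#|Sigma|).
(* The order in which decryption goes through the subsets of size n - l. *)
Variable subsets : seq {set 'I_n}.
Variables (lambda : nat) (AE : auth_enc lambda message).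
Variable SF : shamir_field lambda n.
Variable PG : paillier_keygen #|Sigma| n lambda.

Inductive ham_ctxt (N : nat) : Type :=
| HamReg of {ffun 'I_n -> 'Z_(N ^ 2)}
| HamCond of {ffun 'I_n -> 'Z_(N ^ 2)} & ae_ctxt AE.

Definition ham_flag (N : nat) (c : ham_ctxt N) : bool :=
  if c is HamCond _ _ then true else false.

Definition ham_keygen (r : pk_coins PG) : (nat * nat) * nat :=
  ((pk_p r, pk_q r), (pk_p r * pk_q r)%N).

Definition ham_enc (N : nat) (m : message) (r : {ffun 'I_n -> {unit 'Z_N}}) :
    ham_ctxt N :=
  HamReg [ffun i => p_enc (toInt (m i))%:R (r i)].

(* The largest value of the multiplier a_i in x_i = a_i * 2 ^ lambda + s_i. *)
Definition renc_bound (N s : nat) : nat := ((N - 1 - s) %/ 2 ^ lambda)%N.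

Definition ham_condenc (N : nat) (c : ham_ctxt N) (m2 m3 : message) :
    rnd (option (ham_ctxt N)) :=
  match c with
  | HamCond _ _ => Ret None
  | HamReg c1 =>
      K <-$ unif_key lambda ;;
      cae <-$ ae_enc AE K m3 ;;
      sh <-$ share_gen (sf_pt SF) (etrans (subn_gt0 l n) hl)
                (sf_of_key SF K) ;;
      let s i : nat := sf_to_nat (sh i) in
      a <-$ unif ([ffun => ord0] :
              {dffun forall i : 'I_n, 'I_(renc_bound N (s i)).+1}) ;;
      rr <-$ unif ([ffun => 0] : {ffun 'I_n -> 'Z_N}) ;;
      r <-$ unif ([ffun => 1%g] : {ffun 'I_n -> {unit 'Z_N}}) ;;
      let x i : nat := (a i * 2 ^ lambda + s i)%N in
      Ret (Some (HamCond [ffun i =>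
        c1 i ^+ rr i
        * N.+1%:R ^ ((x i)%:Z - (rr i)%:Z * (toInt (m2 i))%:Z)
        * (val (r i) : nat)%:R ^+ N] cae))
  end.

(* [Some g] if every [f i] is [Some (g i)], and [None] otherwise. *)
Definition all_some (I T : finType) (f : I -> option T) :
    option {ffun I -> T} :=
  [pick g : {ffun I -> T} | [forall i, f i == Some (g i)]].

Definition ofInt (v : nat) : option Sigma :=
  [pick a | toInt a == v :> nat].

Definition nat_to_share (v : nat) : sf_field SF :=
  sf_of_nat SF (Ordinal (ltn_pmod v (expn_gt0 2 lambda))).

Definition ham_dec (N : nat) (sk : nat * nat) (c : ham_ctxt N) :
    option message :=
  match c with
  | HamReg c0 =>
      all_some (fun i => obind (fun v : 'Z_N => ofInt v) (p_dec (c0 i)))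
  | HamCond c1 cae =>
      if all_some (fun i => p_dec (c1 i)) is Some v then
        let s' := [ffun i => nat_to_share (v i)] in
        ohead (pmap (fun S =>
          ae_dec (sf_to_key (secret_recover (sf_pt SF) S s')) cae) subsets)
      else None
  end.

Fact always_bind (A B : Type) (t : rnd A) (f : A -> rnd B) (Q : B -> Prop) :
  (forall a, always (f a) Q) -> always (bind t f) Q.
Proof. by move=> fQ; elim: t => //= T _ k IH y; apply: IH. Qed.

Fact ham_enc_flag (N : nat) m r : ham_flag (@ham_enc N m r) = false.
Proof. by []. Qed.

Fact ham_condenc_flag0 (N : nat) (c : ham_ctxt N) m2 m3 :
  ham_flag c = false ->
  always (ham_condenc c m2 m3)
    (fun o => if o is Some c' then ham_flag c' = true else False).
Proof. by case: c => // c _; do 6!(apply: always_bind => ?). Qed.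

Fact ham_condenc_flag1 (N : nat) (c : ham_ctxt N) m2 m3 :
  ham_flag c = true -> ham_condenc c m2 m3 = Ret None.
Proof. by case: c. Qed.

Definition ham_scheme : cond_enc message := {|
  ce_kcoins := pk_coins PG;
  ce_sk := (nat * nat)%type;
  ce_pk := nat;
  ce_keygen := ham_keygen;
  ce_ctxt := ham_ctxt;
  ce_flag := ham_flag;
  ce_ecoins := fun N => {ffun 'I_n -> {unit 'Z_N}};
  ce_enc := ham_enc;
  ce_condenc := ham_condenc;
  ce_dec := ham_dec;
  ce_enc_flag := ham_enc_flag;
  ce_condenc_flag0 := ham_condenc_flag0;
  ce_condenc_flag1 := ham_condenc_flag1
|}.

End Hamming.

(* Main.v *)
(* Homomorphic evaluation gives a ciphertext of [x_i + R_i (m1[i] - m2[i])].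
   Where the messages agree this is [x_i < N], so reducing modulo [2 ^ lambda]
   returns the share [s_i]; a set of [n - l] such positions recovers [K].  Where
   they differ, [m1[i] - m2[i]] is smaller than both primes, hence a unit modulo
   [N], and [R_i] makes the plaintext uniform.  A set [S] with such a position
   [i] yields a key that is affine in the [i]-th share with nonzero slope, so
   that each key has probability at most [2 ^- lambda * (1 + 2 ^ lambda / N)],
   given all the other coins.  The union bound over [S] fails with probability
   at most [C(n, l) * (1 + 2 ^ lambda / N) * eps_AE]; this is at most [eps]
   if [C(n, l) * eps_AE <= 1], because [2 ^ (2 * lambda) <= N], and
   otherwise [1 - eps < 0]. *)

Require Import Defs.
From HB Require Import structures.
From mathcomp Require Import all_boot all_order all_fingroup all_algebra.
From mathcomp Require Import cyclic ring.
Set Implicit Arguments.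
Unset Strict Implicit.
Unset Printing Implicit Defensive.
Import Order.TTheory GRing.Theory Num.Theory.
Local Open Scope ring_scope.

(** * Expectation over finite random experiments *)

Section Expectation.
Variable R : realFieldType.

Fixpoint Ex (A : Type) (t : rnd A) (f : A -> R) : R :=
  match t with
  | Ret a => f a
  | Draw T _ k => (\sum_(x : T) Ex (k x) f) / #|T|%:R
  end.

Lemma PrE (A : Type) (t : rnd A) (E : A -> bool) :
  Pr R t E = Ex t (fun a => (E a)%:R).
Proof.
by elim: t => //= T _ k IH; congr (_ / _); apply: eq_bigr => x _; apply: IH.
Qed.

Lemma Ex_bind (A B : Type) (t : rnd A) (u : A -> rnd B) (f : B -> R) :
  Ex (bind t u) f = Ex t (fun a => Ex (u a) f).
Proof.
by elim: t => //= T _ k IH; congr (_ / _); apply: eq_bigr => x _; apply: IH.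
Qed.

Lemma Ex_unif (T : finType) (x0 : T) (f : T -> R) :
  Ex (unif x0) f = (\sum_x f x) / #|T|%:R.
Proof. by []. Qed.

Lemma natr_card_gt0 (T : finType) (x0 : T) : 0 < #|T|%:R :> R.
Proof. by rewrite ltr0n; apply/card_gt0P; exists x0. Qed.

Lemma eq_Ex (A : Type) (t : rnd A) (f g : A -> R) :
  f =1 g -> Ex t f = Ex t g.
Proof.
move=> fg; elim: t => //= T _ k IH; congr (_ / _).
by apply: eq_bigr => x _; apply: IH.
Qed.

(** The affine form covers constants, scalar multiples and, with [b = -1], complements of events in
    a single induction. *)
Lemma Ex_linear (A : Type) (t : rnd A) (f : A -> R) (a b : R) :
  Ex t (fun x => a + b * f x) = a + b * Ex t f.
Proof.
elim: t => //= T x0 k IH.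
rewrite (eq_bigr (fun x => a + b * Ex (k x) f)) => [|x _]; last exact: IH.
rewrite big_split /= sumr_const -mulr_sumr mulrDl -mulrA -[a *+ _]mulr_natr.
by rewrite mulfK // gt_eqF // (natr_card_gt0 x0).
Qed.

Lemma Ex_const (A : Type) (t : rnd A) (a : R) : Ex t (fun=> a) = a.
Proof.
rewrite -[RHS]addr0 -(mul0r (Ex t (fun=> 0))) -Ex_linear.
by apply: eq_Ex => x; rewrite mul0r addr0.
Qed.

(** The invariant [Q] brings facts that hold on the support only, such as [ae_encK], under the
    expectation. *)
Lemma ler_Ex (A : Type) (t : rnd A) (Q : A -> Prop) (f g : A -> R) :
  always t Q -> (forall a, Q a -> f a <= g a) -> Ex t f <= Ex t g.
Proof.
move=> tQ fg; elim: t tQ => /= [a|T x0 k IH] tQ; first exact: fg.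
rewrite ler_pM2r ?invr_gt0 ?(natr_card_gt0 x0) // ler_sum // => x _.
exact: IH.
Qed.

Lemma alwaysT (A : Type) (t : rnd A) : always t (fun=> True).
Proof. by elim: t. Qed.

Lemma Ex_ge (A : Type) (t : rnd A) (Q : A -> Prop) (f : A -> R) (c : R) :
  always t Q -> (forall a, Q a -> c <= f a) -> c <= Ex t f.
Proof. by move=> tQ cf; rewrite -(Ex_const t c); apply: ler_Ex tQ cf. Qed.

Lemma Ex_sum (A : Type) (t : rnd A) (I : finType) (P : pred I)
    (F : I -> A -> R) :
  Ex t (fun a => \sum_(i | P i) F i a) = \sum_(i | P i) Ex t (F i).
Proof.
elim: t => //= T x0 k IH; rewrite -mulr_suml exchange_big /=.
by congr (_ / _); apply: eq_bigr => x _; apply: IH.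
Qed.

Lemma Ex_exchange (A B : Type) (t : rnd A) (u : rnd B) (f : A -> B -> R) :
  Ex t (fun a => Ex u (f a)) = Ex u (fun b => Ex t (f^~ b)).
Proof.
elim: t => //= T x0 k IH; under eq_bigr => x _ do rewrite IH.
rewrite -Ex_sum mulrC -[LHS]add0r -Ex_linear.
by apply: eq_Ex => b; rewrite add0r mulrC.
Qed.

(* Resampling one coordinate of a uniform function keeps it uniform: the
   exchange of [f i] and [t] is an involution on the pairs [(f, t)]. *)
Lemma sum_resample (I T : finType) (i : I) (G : {ffun I -> T} -> R) :
  \sum_(f : {ffun I -> T}) \sum_(t : T)
    G [ffun j => if j == i then t else f j] =
  #|T|%:R * \sum_f G f.
Proof.
pose upd (u : {ffun I -> T} * T) : {ffun I -> T} * T :=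
  ([ffun j => if j == i then u.2 else u.1 j], u.1 i).
have updK : involutive upd.
  case=> f t; congr (_, _); rewrite /= ?ffunE ?eqxx //.
  by apply/ffunP=> j; rewrite !ffunE; case: eqP => [->|].
rewrite pair_bigA (eq_bigr (fun u => G (upd u).1)) => [|[f t] _] //.
rewrite (reindex_inj (inv_inj updK)) (eq_bigr (fun u => G u.1)); last first.
  by move=> u _; rewrite updK.
rewrite -(pair_bigA _ (fun f (_ : T) => G f)) /= mulr_sumr.
by apply: eq_bigr => f _; rewrite sumr_const mulr_natl.
Qed.

(** By resampling, it suffices to bound the average over coordinate [i] with all other coordinates
    frozen. *)
Lemma Ex_unif_ffun_le (I T : finType) (i : I) (f0 : {ffun I -> T})
    (G : {ffun I -> T} -> R) (B : R) :
  (forall f : {ffun I -> T},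
     \sum_(t : T) G [ffun j => if j == i then t else f j] <= #|T|%:R * B) ->
  Ex (unif f0) G <= B.
Proof.
move=> GB; rewrite Ex_unif ler_pdivrMr ?(natr_card_gt0 f0) //.
have T0 : 0 < #|T|%:R :> R := natr_card_gt0 (f0 i).
rewrite -(ler_pM2l T0) -(sum_resample i).
rewrite (le_trans (ler_sum _ (fun f _ => GB f))) //.
by rewrite sumr_const -[_ *+ _]mulr_natr mulrA.
Qed.

End Expectation.

(** * Residues and the near-uniformity of reduction modulo [M] *)

Section ModularArithmetic.

Lemma Zp_natr_eq (P a b : nat) : (1 < P)%N ->
  (a%:R == b%:R :> 'Z_P) = (a == b %[mod P])%N.
Proof. by move=> P1; rewrite -val_eqE /= !val_Zp_nat. Qed.

Lemma val_Zp_ltn (P : nat) (m : 'Z_P) : (1 < P)%N -> (m < P)%N.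
Proof. by move=> P1; rewrite -[X in (_ < X)%N](Zp_cast P1). Qed.

Lemma card_Zp_ord (P : nat) : (1 < P)%N -> #|'Z_P| = P.
Proof. by move=> P1; rewrite card_ord Zp_cast. Qed.

(** Once the remainder is fixed, [v] is determined by its quotient [v %/ M], which lies between [0]
    and [P %/ M]. *)
Lemma card_modn_fiber (P M : nat) (z : 'I_M) : (1 < P)%N ->
  (#|[set v : 'Z_P | ((v : nat) %% M)%N == z]| <= P %/ M + 1)%N.
Proof.
move=> P1.
pose f (v : 'Z_P) : 'I_(P %/ M).+1 := inord (v %/ M)%N.
have fE (v : 'Z_P) : f v = (v %/ M)%N :> nat.
  by rewrite inordK // ltnS leq_div2r // ltnW // val_Zp_ltn.
rewrite addn1 -[X in (_ <= X)%N]card_ord -(@card_in_imset _ _ f) ?max_card //.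
move=> v w; rewrite !inE => /eqP vz /eqP wz /(congr1 (@nat_of_ord _)).
rewrite !fE => vw.
by apply: val_inj; rewrite /= (divn_eq v M) (divn_eq w M) vz wz vw.
Qed.

Lemma sum_modn_le (R : numDomainType) (P M : nat) (G : 'I_M -> R)
    (h : 'Z_P -> 'I_M) : (1 < P)%N ->
  (forall z, 0 <= G z) -> (forall v, h v = v %% M :> nat)%N ->
  \sum_v G (h v) <= (P %/ M + 1)%:R * \sum_z G z.
Proof.
move=> P1 G0 hE; rewrite (partition_big h predT) //= mulr_sumr.
apply: ler_sum => z _.
rewrite (eq_bigr (fun=> G z)) => [|v /eqP->] //.
rewrite sumr_const -[G z *+ _]mulr_natl ler_wpM2r // ler_nat.
apply: leq_trans (card_modn_fiber z P1); rewrite subset_leq_card //.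
by apply/subsetP => v /eqP/val_inj <-; rewrite inE hE.
Qed.

End ModularArithmetic.

Lemma val_ZpD (P : nat) (a b : 'Z_P) : (1 < P)%N ->
  (a + b : 'Z_P) = ((a + b) %% P)%N :> nat.
Proof.
move=> P1; rewrite -[in LHS](natr_Zp a) -[in LHS](natr_Zp b) -natrD.
exact: val_Zp_nat.
Qed.

Lemma val_ZpM (P : nat) (a b : 'Z_P) : (1 < P)%N ->
  (a * b : 'Z_P) = ((a * b) %% P)%N :> nat.
Proof.
move=> P1; rewrite -[in LHS](natr_Zp a) -[in LHS](natr_Zp b) -natrM.
exact: val_Zp_nat.
Qed.

Lemma val_Zp1 (P : nat) : (1 < P)%N -> (1 : 'Z_P) = 1%N :> nat.
Proof. by move=> P1; rewrite -[1]/(1%:R) val_Zp_nat // modn_small. Qed.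

(** * Homomorphic laws and unique decryption for Paillier *)

Section PaillierTheory.
Variables p q : nat.
Hypotheses (p_pr : prime p) (q_pr : prime q) (pq_neq : p != q).
Hypothesis pq_coprime : coprime (p * q) (p.-1 * q.-1).
Local Notation N := (p * q)%N.

Lemma paillier_gt1 : (1 < N)%N.
Proof.
by rewrite (leq_trans (prime_gt1 p_pr)) // leq_pmulr // prime_gt0.
Qed.
Let N1 := paillier_gt1.

Let N0 : (0 < N)%N. Proof. exact: ltnW N1. Qed.

Let NN1 : (1 < N ^ 2)%N.
Proof. by rewrite (leq_trans N1) // leq_pmulr. Qed.

Lemma totient_sqr : totient (N ^ 2) = (N * (p.-1 * q.-1))%N.
Proof.
have cpq : coprime p q by rewrite prime_coprime // dvdn_prime2.
rewrite expnMn totient_coprime ?coprimeXl ?coprimeXr //.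
by rewrite !totient_pfactor // !expn1 mulnACA mulnC.
Qed.

(** The binomial expansion stops after the linear term. At [k = 0] the truncated exponent [k.-1] is
    harmless because the factor [k%:R] vanishes. *)
Lemma exprD_nilpotent (A : comNzRingType) (x e : A) (k : nat) : e * e = 0 ->
  (x + e) ^+ k = x ^+ k + k%:R * x ^+ k.-1 * e.
Proof.
move=> ee0; elim: k => [|[|k] IH] /=; first by rewrite !mul0r addr0.
  by rewrite !expr1 expr0 !mul1r.
rewrite exprS IH.
transitivity (x ^+ k.+2 + k.+2%:R * x ^+ k.+1 * e + k.+1%:R * x ^+ k * (e * e)).
  by rewrite -!natr1 !exprS; ring.
by rewrite ee0 mulr0 addr0.
Qed.

Let NN0 : N%:R * N%:R = 0 :> 'Z_(N ^ 2).
Proof. by rewrite -natrM pchar_Zp. Qed.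

(** Changing the base by a multiple of [N] adds a linear term with one factor [N] from the exponent
    and another from the change, and [N * N = 0]. Nonces thus matter only modulo [N]. *)
Lemma natr_expN_modn (a b : nat) : a = b %[mod N] ->
  a%:R ^+ N = b%:R ^+ N :> 'Z_(N ^ 2).
Proof.
suff E (c : nat) : c%:R ^+ N = (c %% N)%:R ^+ N :> 'Z_(N ^ 2).
  by move=> ab; rewrite E ab -E.
have -> : c%:R = (c %% N)%:R + (c %/ N)%:R * N%:R :> 'Z_(N ^ 2).
  by rewrite -natrM -natrD addnC -divn_eq.
rewrite exprD_nilpotent; last by rewrite mulrACA NN0 mulr0.
by rewrite [(c %/ N)%:R * _]mulrC mulrACA NN0 mul0r addr0.
Qed.

Lemma paillier_gen_exp (k : nat) :
  N.+1%:R ^+ k = 1 + (k * N)%:R :> 'Z_(N ^ 2).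
Proof.
by rewrite -[N.+1]add1n natrD exprD_nilpotent // !expr1n mulr1 (natrM _ k N).
Qed.

Lemma paillier_gen_exp_modn (a b : nat) : a = b %[mod N] ->
  N.+1%:R ^+ a = N.+1%:R ^+ b :> 'Z_(N ^ 2).
Proof.
move=> ab; rewrite !paillier_gen_exp; congr (1 + _); apply/eqP.
by rewrite Zp_natr_eq // expnS expn1 -!muln_modl ab.
Qed.

Lemma p_encM (m m' : 'Z_N) (r r' : {unit 'Z_N}) :
  p_enc m r * p_enc m' r' = p_enc (m + m') (r * r')%g.
Proof.
rewrite /p_enc mulrACA -exprD -exprMn -natrM; congr (_ * _).
  by apply: paillier_gen_exp_modn; rewrite val_ZpD // modn_mod.
by apply: natr_expN_modn; rewrite FinRing.val_unitM val_ZpM // modn_mod.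
Qed.

Lemma p_enc01 : p_enc (0 : 'Z_N) 1%g = 1.
Proof.
by rewrite /p_enc expr0 mul1r FinRing.val_unit1 val_Zp1 // expr1n.
Qed.

Lemma p_encX (m : 'Z_N) (r : {unit 'Z_N}) (k : nat) :
  p_enc m r ^+ k = p_enc (m *+ k) (r ^+ k)%g.
Proof.
elim: k => [|k IH]; first by rewrite expr0 mulr0n expg0 p_enc01.
by rewrite exprS IH p_encM mulrS expgS.
Qed.

Lemma p_encV (m : 'Z_N) (r : {unit 'Z_N}) : (p_enc m r)^-1 = p_enc (- m) r^-1%g.
Proof.
have E : p_enc m r * p_enc (- m) r^-1%g = 1.
  by rewrite p_encM subrr mulgV p_enc01.
have U : p_enc m r \is a GRing.unit.
  by apply/unitrPr; exists (p_enc (- m) r^-1%g).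
by rewrite -[LHS]mulr1 -E mulKr.
Qed.

(** The generator's exponent in a conditional ciphertext may be negative; the nonce [1] is stable
    under powers and inverses. *)
Lemma p_encXz (m : 'Z_N) (k : int) :
  p_enc m 1%g ^ k = p_enc (m *~ k) 1%g.
Proof.
by case: k => k; rewrite ?NegzE -?exprnN -?exprnP ?p_encX ?p_encV expg1n
  ?invg1 //= ?mulrNz.
Qed.

Lemma p_enc_gen : N.+1%:R = p_enc (1 : 'Z_N) 1%g.
Proof.
by rewrite /p_enc FinRing.val_unit1 val_Zp1 // expr1 expr1n mulr1.
Qed.

Lemma p_enc_nonce (r : {unit 'Z_N}) :
  (val r : nat)%:R ^+ N = p_enc (0 : 'Z_N) r.
Proof. by rewrite /p_enc expr0 mul1r. Qed.

(** Raising to the power [t = (p-1)(q-1)] kills the nonce, since [N * t] is the totient of [N ^ 2].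
    What remains is [1 + m * t * N = 1] modulo [N ^ 2], so [N] divides [m * t], hence [m] by
    coprimality. *)
Lemma p_enc_eq1 (m : 'Z_N) (r : {unit 'Z_N}) : p_enc m r = 1 -> m = 0.
Proof.
move=> E; pose t := (p.-1 * q.-1)%N.
have rt : (val (r ^+ t)%g : nat)%:R ^+ N = 1 :> 'Z_(N ^ 2).
  have cr : coprime (val r : nat) (N ^ 2).
    rewrite coprimeXr // coprime_sym -unitZpE // natr_Zp; exact: valP r.
  transitivity ((val r : nat)%:R ^+ t ^+ N : 'Z_(N ^ 2)).
    (* The power [r ^+ t] is taken in ['Z_N], but its [N]-th power depends only on the residue
       modulo [N], so it may be computed on integers. *)
    rewrite -(natrX _ _ t); apply: natr_expN_modn; apply/eqP.
    rewrite -Zp_natr_eq //.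
    by rewrite natrX !natr_Zp FinRing.val_unitX.
  rewrite -exprM (mulnC t) -totient_sqr -(natrX _ _ (totient _)).
  by apply/eqP; rewrite -[1]/(1%:R) Zp_natr_eq //; apply/eqP/Euler_exp_totient.
have := congr1 (fun c => c ^+ t) E; rewrite expr1n p_encX /p_enc rt mulr1.
rewrite paillier_gen_exp => /eqP; rewrite -subr_eq0 addrC addKr.
have -> : 0 = 0%:R :> 'Z_(N ^ 2) by [].
rewrite Zp_natr_eq // mod0n expnS expn1 -/(dvdn _ _) dvdn_pmul2r //.
have -> : (m *+ t : 'Z_N) = (m * t)%N%:R by rewrite natrM natr_Zp mulr_natr.
rewrite val_Zp_nat // /dvdn modn_mod -/(dvdn _ _) Gauss_dvdl //.
move=> /eqP; rewrite modn_small ?val_Zp_ltn // => m0; exact: val_inj.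
Qed.

(** If [m'] also explains the ciphertext, the quotient of the two encryptions is [1] and encrypts
    [m - m'], so the choice made by [pick] is forced. *)
Lemma p_dec_enc (m : 'Z_N) (r : {unit 'Z_N}) : p_dec (p_enc m r) = Some m.
Proof.
rewrite /p_dec; case: pickP => [m' /existsP[r' /eqP E]|/(_ m)/existsP[]].
  have := p_encM m (- m') r r'^-1%g; rewrite -p_encV -E E divrr => [/esym|].
    by move/p_enc_eq1/subr0_eq ->.
  by apply/unitrPr; exists (p_enc (- m') r'^-1%g);
    rewrite p_encM subrr mulgV p_enc01.
by exists r.
Qed.

Lemma p_dec_condenc (m k : 'Z_N) (rho r : {unit 'Z_N}) (x t : nat) :
  p_dec (p_enc m rho ^+ k * N.+1%:R ^ (x%:Z - k%:Z * t%:Z)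
         * (val r : nat)%:R ^+ N) = Some (k * (m - t%:R) + x%:R).
Proof.
rewrite p_encX p_enc_gen p_encXz p_enc_nonce !p_encM p_dec_enc; congr Some.
rewrite addr0 -[m *+ _]mulr_natr natr_Zp rmorphB rmorphM /= -!pmulrn natr_Zp.
by rewrite mulrBr [m * k]mulrC -addrA [x%:R + _]addrC.
Qed.

(** The difference is nonzero and smaller than both primes, so neither divides it. *)
Lemma unitZp_subr (a b : nat) : (a < minn p q)%N -> (b < minn p q)%N ->
  a != b -> (a%:R - b%:R : 'Z_N) \is a GRing.unit.
Proof.
wlog ab : a b / (b < a)%N => [W ha hb|ha _ _].
  case: (ltngtP a b) => // ab _; last by rewrite W // gtn_eqF.
  by rewrite -opprB unitrN W // gtn_eqF.
rewrite -natrB ?(ltnW ab) // unitZpE //.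
have h : (0 < a - b < minn p q)%N.
  by rewrite subn_gt0 ab (leq_ltn_trans (leq_subr _ _)).
move: h; rewrite leq_min => /and3P[d0 dp dq].
by rewrite coprimeMl !prime_coprime // !gtnNdvd.
Qed.

End PaillierTheory.

(** * Lagrange interpolation at the point of the secret *)

Section ShamirTheory.
Variables (F : finFieldType) (n : nat) (x : 'I_n.+1 -> F).
Hypothesis x_inj : injective x.
Local Notation pt i := (x (lift ord0 i)).

(** The value at the secret's point of the Lagrange basis polynomial of node [i]. It is nonzero
    because that point is none of the nodes. *)
Definition lagrange_coef (S : {set 'I_n}) (i : 'I_n) : F :=
  \prod_(j in S :\ i) ((pt i - pt j)^-1 * (x ord0 - pt j)).

Lemma secret_recoverE (S : {set 'I_n}) (y : {ffun 'I_n -> F}) :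
  secret_recover x S y = \sum_(i in S) y i * lagrange_coef S i.
Proof.
rewrite /secret_recover horner_sum; apply: eq_bigr => i _.
rewrite hornerZ horner_prod; congr (_ * _); apply: eq_bigr => j _.
by rewrite hornerZ hornerXsubC.
Qed.

Lemma lagrange_coef_neq0 (S : {set 'I_n}) (i : 'I_n) : lagrange_coef S i != 0.
Proof.
apply/prodf_neq0 => j; rewrite !inE => /andP[ji _].
rewrite mulf_neq0 ?invr_eq0 ?subr_eq0 ?(inj_eq x_inj) ?neq_lift //.
by rewrite (inj_eq lift_inj) eq_sym.
Qed.

Lemma secret_recover_affine (S : {set 'I_n}) (i : 'I_n)
    (y : {ffun 'I_n -> F}) : i \in S ->
  secret_recover x S y =
  y i * lagrange_coef S i + \sum_(j in S | j != i) y j * lagrange_coef S j.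
Proof. by move=> iS; rewrite secret_recoverE (bigD1 i). Qed.

(** The interpolant minus [phi] has size at most [#|S|] and vanishes at [#|S|] distinct points, so
    it is zero. *)
Lemma secret_recover_horner (S : {set 'I_n}) (y : {ffun 'I_n -> F})
    (phi : {poly F}) : (size phi <= #|S|)%N ->
  {in S, forall i, y i = phi.[pt i]} -> secret_recover x S y = phi.[x ord0].
Proof.
move=> phiS yE; rewrite /secret_recover; set psi := \sum_(i in S) _.
suff /eqP : psi - phi = 0 by rewrite subr_eq0 => /eqP ->.
have psi_pt i : i \in S -> psi.[pt i] = y i.
  move=> iS; rewrite horner_sum (bigD1 i) //=.
  rewrite [X in _ + X]big1 ?addr0 => [|j /andP[jS ji]].
    rewrite hornerZ horner_prod big1 ?mulr1 // => j.
    rewrite !inE => /andP[ji _].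
    rewrite hornerZ hornerXsubC mulVf // subr_eq0 (inj_eq x_inj).
    by rewrite (inj_eq lift_inj) eq_sym.
  rewrite hornerZ horner_prod (bigD1 i) ?inE ?iS 1?eq_sym ?ji //=.
  by rewrite hornerZ hornerXsubC subrr mulr0 mul0r mulr0.
apply: (@roots_geq_poly_eq0 _ _ [seq pt i | i <- enum S]).
- apply/allP => _ /mapP[i iS ->]; rewrite mem_enum in iS.
  by rewrite /root hornerD hornerN psi_pt // yE // subrr.
- by rewrite map_inj_uniq ?enum_uniq // => i j /x_inj/lift_inj.
rewrite size_map -cardE (leq_trans (size_polyD _ _)) // size_polyN geq_max phiS.
rewrite andbT; apply/(leq_trans (size_sum _ _ _))/bigmax_leqP => i iS.
apply: leq_trans (size_scale_leq _ _) _; rewrite (cardsD1 i) iS.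
rewrite scaler_prod; apply: leq_trans (size_scale_leq _ _) _.
by rewrite -big_enum size_prod_XsubC -cardE.
Qed.

End ShamirTheory.

(** * From a blinded plaintext to a nearly uniform key *)

Section ShareUniformity.
Variables (R : realFieldType) (lambda n : nat) (SF : shamir_field lambda n).

Lemma nat_to_share_id (v : nat) (s : 'I_(2 ^ lambda)) :
  v = s %[mod 2 ^ lambda] ->
  nat_to_share SF v = sf_of_nat SF s.
Proof.
by move=> vs; congr (sf_of_nat SF _); apply: val_inj; rewrite /= vs modn_small.
Qed.

(** Both affine maps are bijections, on ['Z_P] because [u] is a unit and on the field because
    [c != 0]. Only the reduction modulo [2 ^ lambda] between them is not injective, and its fibers
    have at most [P %/ 2 ^ lambda + 1] elements. *)
Lemma sum_key_le (P : nat) (u w : 'Z_P) (c b : sf_field SF)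
    (G : key lambda -> R) : (1 < P)%N -> u \is a GRing.unit -> c != 0 ->
  (forall k, 0 <= G k) ->
  \sum_(t : 'Z_P)
    G (sf_to_key (nat_to_share SF (t * u + w : 'Z_P)%R * c + b)) <=
  (P %/ 2 ^ lambda + 1)%:R * \sum_k G k.
Proof.
move=> P1 uU c0 G0; pose g z := sf_to_key (sf_of_nat SF z * c + b).
have u_inj : injective (fun t : 'Z_P => t * u + w).
  by move=> t t' /addIr /(mulIr uU).
pose h (v : 'Z_P) := Ordinal (ltn_pmod v (expn_gt0 2 lambda)).
rewrite [leLHS](_ : _ = \sum_v G (g (h v))); last first.
  by rewrite [RHS](reindex_inj u_inj).
apply: le_trans (sum_modn_le (G := G \o g) (h := h) P1 _ _) _ => // [z|].
  exact: G0.
rewrite ler_wpM2l // [leRHS](reindex g) //.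
exists (fun k => sf_to_nat ((sf_of_key SF k - b) / c)) => [z _|k _].
  by rewrite /g sf_to_keyK addrK mulfK // sf_of_natK.
by rewrite /g sf_to_natK divfK // subrK sf_of_keyK.
Qed.

End ShareUniformity.

(** * First success in a list, total families, and the support of share generation *)

(** All successes agree on [b], so the order of the search is irrelevant. *)
Lemma ohead_pmap_some (A B : eqType) (f : A -> option B) (s : seq A) (b : B) :
  {in s, forall a, f a = None \/ f a = Some b} ->
  (exists2 a, a \in s & f a = Some b) -> ohead (pmap f s) = Some b.
Proof.
elim: s => [|a s IH] fs [c]; first by rewrite in_nil.
have [fa|fa _ _] := fs a (mem_head _ _); rewrite /= fa //=.
  rewrite inE => /predU1P[->|cs fc]; first by rewrite fa.
  by apply: IH => [d ds|]; [apply: fs; rewrite inE ds orbT|exists c].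
Qed.

Lemma ohead_pmap_none (A B : eqType) (f : A -> option B) (s : seq A) :
  {in s, forall a, f a = None} -> ohead (pmap f s) = None.
Proof.
elim: s => //= a s IH fs; rewrite fs ?mem_head //=.
by apply: IH => c cs; apply: fs; rewrite inE cs orbT.
Qed.

Lemma all_some_Some (I T : finType) (f : I -> option T) (g : {ffun I -> T}) :
  (forall i, f i = Some (g i)) -> all_some f = Some g.
Proof.
move=> fg; rewrite /all_some; case: pickP => [h /forallP fh|/(_ g)/forallP[i]].
  by congr Some; apply/ffunP => i; have /eqP := fh i; rewrite fg => -[].
by apply/eqP.
Qed.

Lemma always_share_gen (F : finFieldType) (n t : nat) (x : 'I_n.+1 -> F)
    (ht : (0 < t)%N) (s : F) :
  always (share_gen x ht s) (fun sh => exists phi : {poly F},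
    [/\ (size phi <= t)%N, phi.[x ord0] = s
      & forall i, sh i = phi.[x (lift ord0 i)]]).
Proof.
move=> phi /=; exists (val phi : {poly F}); split.
- exact: size_npoly.
- exact/eqP/(valP phi).
by move=> i; rewrite ffunE.
Qed.

(** * Keys recovered by decryption and the union bound over subsets *)

Section HammingTheory.
Variables (R : realFieldType) (Sigma : finType) (toInt : Sigma -> 'I_#|Sigma|).
Hypothesis toInt_inj : injective toInt.
Variables (n l : nat) (hl : (l < n)%N) (subsets : seq {set 'I_n}).
Hypothesis subsetsP : subsets =i [set S : {set 'I_n} | #|S| == (n - l)%N].
Variables (lambda : nat) (AE : auth_enc lambda (message Sigma n)).
Variables (SF : shamir_field lambda n).
Variable PG : paillier_keygen #|Sigma| n lambda.
Variable r1 : pk_coins PG.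
Local Notation p := (pk_p r1).
Local Notation q := (pk_q r1).
Local Notation N := (p * q)%N.
Local Notation message := (message Sigma n).
Local Notation eps :=
  ('C(n, l)%:R * eps_AE R AE + 2 ^- lambda).

Let p_pr : prime p := pk_p_prime r1.
Let q_pr : prime q := pk_q_prime r1.
Let pq_neq : p != q := pk_pq_neq r1.
Let pq_co : coprime (p * q) (p.-1 * q.-1) := pk_coprime r1.
Let N1 : (1 < N)%N := paillier_gt1 p_pr q_pr.

Lemma toInt_lt_pq (a : Sigma) : (toInt a < minn p q)%N.
Proof. exact: leq_trans (ltn_ord _) (pk_min r1). Qed.

Lemma toInt_lt_N (a : Sigma) : (toInt a < N)%N.
Proof.
apply: leq_trans (toInt_lt_pq a) (leq_trans (geq_minl _ _) _).
by rewrite leq_pmulr // prime_gt0.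
Qed.

Lemma ham_dec_enc (sk : nat * nat) (m : message)
    (r : {ffun 'I_n -> {unit 'Z_N}}) :
  ham_dec toInt subsets SF sk (ham_enc toInt AE m r) = Some m.
Proof.
apply: all_some_Some => i; rewrite ffunE p_dec_enc //=.
rewrite val_Zp_nat // modn_small ?toInt_lt_N // /ofInt.
case: pickP => [a /eqP/val_inj/toInt_inj -> //|/(_ (m i))].
by rewrite eqxx.
Qed.

Variables (m1 m2 : message).

Definition agree : {set 'I_n} := [set i | m1 i == m2 i].

Lemma card_agree : (#|agree| + Ham m1 m2 = n)%N.
Proof.
rewrite /Ham -[RHS]card_ord -(cardsC agree); congr (_ + _)%N.
by apply: eq_card => i; rewrite !inE.
Qed.

(** The plaintexts found when decrypting a conditional ciphertext, as [ham_dec_condenc] confirms. *)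
Definition condenc_plain (x : 'I_n -> nat) (rr : {ffun 'I_n -> 'Z_N}) :
    {ffun 'I_n -> 'Z_N} :=
  [ffun i => rr i * ((toInt (m1 i))%:R - (toInt (m2 i))%:R) + (x i)%:R].

Definition candidate_key (S : {set 'I_n}) (v : {ffun 'I_n -> 'Z_N}) :
    key lambda :=
  sf_to_key (secret_recover (sf_pt SF) S [ffun i => nat_to_share SF (v i)]).

Lemma candidate_key_agree (sh : {ffun 'I_n -> sf_field SF})
    (phi : {poly sf_field SF})
    (a : {dffun forall i : 'I_n,
            'I_(renc_bound lambda N (sf_to_nat (sh i))).+1})
    (rr : {ffun 'I_n -> 'Z_N}) (S : {set 'I_n}) :
  (size phi <= #|S|)%N -> (forall i, sh i = phi.[sf_pt SF (lift ord0 i)]) ->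
  S \subset agree ->
  candidate_key S
    (condenc_plain (fun i => a i * 2 ^ lambda + sf_to_nat (sh i))%N rr) =
  sf_to_key phi.[sf_pt SF ord0].
Proof.
move=> phiS shE /subsetP SA; congr sf_to_key.
apply: secret_recover_horner => //; first exact: sf_pt_inj.
move=> i iS; rewrite !ffunE -shE -[RHS]sf_to_natK; apply: nat_to_share_id.
have := SA i iS; rewrite inE => /eqP ->; rewrite subrr mulr0 add0r.
(* This keeps the subtraction in [renc_bound] from being truncated at zero; it uses
   [2 ^ lambda <= 2 ^ (2 * lambda) <= N]. *)
have sN : (sf_to_nat (sh i) <= N - 1)%N.
  rewrite -ltnS subn1 prednK; last exact: ltnW N1.
  apply: leq_trans (ltn_ord _) (leq_trans _ (pk_large r1)).
  apply: (@leq_trans (2 ^ (2 * lambda))).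
    by rewrite leq_pexp2l // leq_pmull.
  by rewrite leq_pmull // muln_gt0 (leq_ltn_trans _ hl).
(* The bound on [a i] gives [a i * 2 ^ lambda + s <= N - 1], so nothing wraps around modulo [N]. *)
rewrite val_Zp_nat // [X in (X %% 2 ^ _)%N]modn_small ?modnMDl //.
rewrite -[X in (_ < X)%N](prednK (ltnW N1)) ltnS -subn1 addnC -leq_subRL //.
by rewrite -leq_divRL ?expn_gt0 // -ltnS.
Qed.

Lemma sum_candidate_key_le (S : {set 'I_n}) (i : 'I_n) (x : 'I_n -> nat)
    (rr : {ffun 'I_n -> 'Z_N}) (G : key lambda -> R) :
  i \in S -> i \notin agree -> (forall k, 0 <= G k) ->
  \sum_(t : 'Z_N)
    G (candidate_key S (condenc_plain x [ffun j => if j == i then t else rr j]))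
  <= (N %/ 2 ^ lambda + 1)%:R * \sum_k G k.
Proof.
rewrite inE => iS di G0.
have uU : (toInt (m1 i))%:R - (toInt (m2 i))%:R \is a @GRing.unit 'Z_N.
  apply: unitZp_subr; rewrite ?toInt_lt_pq //.
  by apply: contraNN di => /eqP/val_inj/toInt_inj ->.
pose c := lagrange_coef (sf_pt SF) S i.
(* The shares other than the [i]-th do not involve [t]; their contribution is the constant term of
   the affine map. *)
pose b := \sum_(j in S | j != i)
  nat_to_share SF (condenc_plain x rr j) * lagrange_coef (sf_pt SF) S j.
have c0 : c != 0 by apply: lagrange_coef_neq0; exact: sf_pt_inj.
apply: le_trans (sum_key_le (x i)%:R b N1 uU c0 G0).
rewrite le_eqVlt; apply/orP; left; apply/eqP/eq_bigr => t _.
congr (G (sf_to_key _)).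
rewrite (secret_recover_affine _ _ iS) !ffunE eqxx; congr (_ + _).
by apply: eq_bigr => j /andP[_ /negbTE ji]; rewrite !ffunE ji.
Qed.

Variables (r2 : {ffun 'I_n -> {unit 'Z_N}}) (m3 : message).

Definition accept_prob (c : ae_ctxt AE) : R :=
  Ex (unif_key lambda) (fun k => (ae_dec k c != None)%:R).

(** The unrelated key is independent of the ciphertext, so it may be drawn first, as in [eps_AE];
    then [m3] is one term of the maximum. *)
Lemma accept_prob_le :
  Ex (K <-$ unif_key lambda ;; ae_enc AE K m3) accept_prob <= eps_AE R AE.
Proof.
apply: le_trans (le_bigmax _ _ m3).
rewrite PrE [X in _ <= X]Ex_bind [X in X <= _]Ex_exchange le_eqVlt.
apply/orP; left; apply/eqP/eq_Ex => k; rewrite !Ex_bind; apply: eq_Ex => K.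
by rewrite Ex_bind.
Qed.

Lemma ham_dec_condenc (sk : nat * nat) (x : 'I_n -> nat)
    (rr : {ffun 'I_n -> 'Z_N}) (r : {ffun 'I_n -> {unit 'Z_N}})
    (cae : ae_ctxt AE) :
  ham_dec toInt subsets SF sk (HamCond [ffun i =>
    [ffun j => p_enc ((toInt (m1 j))%:R : 'Z_N) (r2 j)] i ^+ rr i
    * N.+1%:R ^ ((x i)%:Z - (rr i)%:Z * (toInt (m2 i))%:Z)
    * (val (r i) : nat)%:R ^+ N] cae) =
  ohead (pmap (fun S => ae_dec (candidate_key S (condenc_plain x rr)) cae)
    subsets).
Proof.
rewrite /= (all_some_Some (g := condenc_plain x rr)) // => i.
by rewrite !ffunE p_dec_condenc.
Qed.

(* If [S] contains a position [i] where the messages differ, then the blinding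
   factor [rr i] alone makes the key recovered from [S] uniform up to the factor
   [1 + 2 ^ lambda / N], whatever the other coins are. *)
Lemma Ex_candidate_key_le (S : {set 'I_n}) (x : 'I_n -> nat)
    (rr0 : {ffun 'I_n -> 'Z_N}) (cae : ae_ctxt AE) : ~~ (S \subset agree) ->
  Ex (unif rr0) (fun rr =>
    (ae_dec (candidate_key S (condenc_plain x rr)) cae != None)%:R)
  <= (1 + 2 ^+ lambda / N%:R) * accept_prob cae.
Proof.
move=> /subsetPn[i iS di]; apply: (Ex_unif_ffun_le (i := i)) => rr.
have := sum_candidate_key_le x rr
  (G := fun k => (ae_dec k cae != None)%:R) iS di (fun k => ler0n _ _).
move/le_trans; apply; rewrite /accept_prob Ex_unif card_Zp_ord //.
rewrite card_tuple card_bool; set M := (2 ^ lambda)%N.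
have M0 : 0 < M%:R :> R by rewrite ltr0n expn_gt0.
have N0 : 0 < N%:R :> R by rewrite ltr0n ltnW.
set s := \sum_k _.
(* With [u = N] and [v = 2 ^ lambda] this turns the target into [(N / 2 ^ lambda + 1) * s], which
   dominates the fiber count with its rounded-down quotient. *)
have E (u v : R) : 0 < u -> 0 < v -> u * ((1 + v / u) * (s / v)) =
    (u / v + 1) * s.
  by move=> /lt0r_neq0 u0 /lt0r_neq0 v0; field; rewrite u0 v0.
rewrite -natrX E // ler_wpM2r ?sumr_ge0 // natrD lerD2r.
rewrite ler_pdivlMr // -natrM ler_nat.
exact: leq_divM.
Qed.

(** Shared by correctness and error detection: [E] has to be checked only for ideal attempts [D],
    where agreeing sets return [m3] and all other sets of size [n - l] fail. *)
Lemma Pr_dec_condenc_ge (E : pred (option message)) :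
  (forall D : {set 'I_n} -> option message,
    (forall S : {set 'I_n}, #|S| = (n - l)%N ->
      S \subset agree -> D S = Some m3) ->
    (forall S : {set 'I_n}, #|S| = (n - l)%N ->
      ~~ (S \subset agree) -> D S = None) ->
    E (ohead (pmap D subsets))) ->
  1 - eps <= Pr R (@dec_condenc _ (ham_scheme hl toInt subsets AE SF PG)
                     r1 m1 r2 m2 m3) E.
Proof.
move=> ED; pose d : R := 2 ^+ lambda / N%:R.
pose t := (K <-$ unif_key lambda ;; ae_enc AE K m3).
have d0 : 0 <= d by rewrite divr_ge0 ?exprn_ge0 ?ler0n.
(* The union bound with its exact loss factor [1 + d]; the additive form of [eps] comes
   afterwards. *)
have step : 1 - 'C(n, l)%:R * (1 + d) * Ex t accept_prob
  <= Pr R (@dec_condenc _ (ham_scheme hl toInt subsets AE SF PG)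
                     r1 m1 r2 m2 m3) E.
  have -> : Pr R (@dec_condenc _ (ham_scheme hl toInt subsets AE SF PG)
                     r1 m1 r2 m2 m3) E =
      Ex (ham_condenc hl toInt SF (ham_enc toInt AE m1 r2) m2 m3)
        (fun o => (E (obind (ham_dec toInt subsets SF (p, q)) o))%:R).
    by rewrite PrE /dec_condenc Ex_bind.
  rewrite -mulNr -Ex_linear Ex_bind /ham_condenc /ham_enc Ex_bind.
  apply: (ler_Ex (alwaysT _)) => K _; rewrite Ex_bind.
  apply: ler_Ex (ae_encK AE K m3) _ => cae caeK; rewrite Ex_bind.
  apply: Ex_ge (@always_share_gen _ _ _ _ _ _) _ => sh [phi [phi_sz phi_s shE]].
  rewrite Ex_bind; apply: Ex_ge (alwaysT _) _ => a _; rewrite Ex_bind.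
  pose x i := (a i * 2 ^ lambda + sf_to_nat (sh i))%N.
  pose bad := [set S : {set 'I_n} | #|S| == (n - l)%N & ~~ (S \subset agree)].
  pose f rr (S : {set 'I_n}) : R :=
    (ae_dec (candidate_key S (condenc_plain x rr)) cae != None)%:R.
  pose rr0 : {ffun 'I_n -> 'Z_N} := [ffun => 0].
  have sumf_ge0 rr : 0 <= \sum_(S in bad) f rr S by rewrite sumr_ge0.
  apply: (@le_trans _ _ (Ex (unif rr0)
    (fun rr => 1 + -1 * \sum_(S in bad) f rr S))).
    rewrite Ex_linear mulN1r mulNr lerD2l lerN2 Ex_sum -mulrA.
    apply: (@le_trans _ _ (\sum_(S in bad) (1 + d) * accept_prob cae)).
      apply: ler_sum => S; rewrite inE => /andP[_ nS].
      exact: Ex_candidate_key_le.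
    rewrite sumr_const -[X in X <= _]mulr_natl ler_wpM2r //.
      rewrite mulr_ge0 ?addr_ge0 //; apply: Ex_ge (alwaysT _) _ => k _.
      exact: ler0n.
    (* Bad sets are among the sets of size [n - l], of which there are ['C(n, n - l) = 'C(n, l)]. *)
    rewrite ler_nat -bin_sub ?(ltnW hl) // -[X in 'C(X, _)]card_ord -card_draws.
    by apply: subset_leq_card; apply/subsetP => S; rewrite !inE => /andP[].
  apply: (ler_Ex (alwaysT _)) => rr _; rewrite Ex_bind.
  apply: Ex_ge (alwaysT _) _ => r _.
  rewrite [leRHS]/= -/(ham_dec toInt subsets SF (p, q) (HamCond _ _)).
  rewrite mulN1r (ham_dec_condenc (p, q) x rr r cae).
  (* If some bad set is accepted, the sum is at least [1] and the lower bound is at most [0];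
     otherwise the attempts are ideal and [E] holds. *)
  have [/existsP[S /andP[bS accS]]|] := boolP [exists S in bad,
      ae_dec (candidate_key S (condenc_plain x rr)) cae != None].
    apply: le_trans (ler0n _ _); rewrite subr_le0 (bigD1 S) //= {1}/f accS.
    by rewrite lerDl sumr_ge0.
  rewrite negb_exists => /forallP nacc; rewrite ED ?gerBl // => S cardS SA.
    by rewrite (candidate_key_agree _ _ _ shE) ?cardS // phi_s sf_of_keyK.
  have := nacc S; rewrite inE cardS eqxx SA /= negbK => /eqP; exact.
have e_le := accept_prob_le.
have C0 : 0 <= 'C(n, l)%:R * Ex t accept_prob.
  by rewrite mulr_ge0 // (Ex_ge (alwaysT _)) // => c _;
    rewrite (Ex_ge (alwaysT _)).
(* The split is on the actual acceptance probability, which [eps_AE] dominates. If the product is at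
   most [1], the excess is at most [d <= 2 ^- lambda]; otherwise [eps] exceeds [1] and the bound is
   trivial. *)
have [C1|C1] := leP ('C(n, l)%:R * Ex t accept_prob) 1.
  apply: le_trans step; rewrite lerD2l lerN2 mulrAC mulrDr mulr1 lerD //.
    by rewrite ler_wpM2l.
  apply: le_trans (ler_piMl d0 C1) _.
  rewrite ler_pdivrMr ?ltr0n 1?ltnW // mulrC ler_pdivlMr ?exprn_gt0 // -exprD.
  rewrite -natrX ler_nat; apply: leq_trans (pk_large r1).
  by rewrite addnn -mul2n leq_pmull // muln_gt0 (leq_ltn_trans _ hl).
apply: le_trans (_ : 0 <= _); last by rewrite PrE (Ex_ge (alwaysT _)).
rewrite subr_le0 (le_trans (ltW C1)) // -[leLHS]addr0 lerD ?ler_wpM2l //.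
by rewrite invr_ge0 exprn_ge0.
Qed.

End HammingTheory.

(** * Correctness and error detection from the common bound *)

Theorem theorem15 (R : realFieldType)
  (Sigma : finType) (toInt : Sigma -> 'I_#|Sigma|) (toInt_bij : bijective toInt)
  (n l : nat) (hl : (l < n)%N)
  (subsets : seq {set 'I_n})
  (subsetsP : subsets =i [set S : {set 'I_n} | #|S| == (n - l)%N])
  (AE : forall lambda, auth_enc lambda (message Sigma n))
  (SF : forall lambda, (n + 1 <= 2 ^ lambda)%N -> shamir_field lambda n)
  (PG : forall lambda, paillier_keygen #|Sigma| n lambda) :
  let L : pred nat := fun lambda => (n + 1 <= 2 ^ lambda)%N in
  let Pi := fun (lambda : nat) (hL : L lambda) =>
    ham_scheme hl toInt subsets (AE lambda) (SF lambda hL) (PG lambda) in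
  let eps := fun lambda : nat =>
    'C(n, l)%:R * eps_AE R (AE lambda) + 2 ^- lambda in
  correct (P_Ham l) Pi eps /\ error_detecting (P_Ham l) Pi eps.
Proof.
have [toInt' toIntK _] := toInt_bij; have toInt_inj := can_inj toIntK.
move=> L Pi eps; split=> lambda hL; first split=> r1 r2.
- by move=> m; apply: ham_dec_enc.
- move=> m1 m2 m3 PHam; apply: Pr_dec_condenc_ge => // D Dgood Dbad.
  apply/eqP/ohead_pmap_some => [S|].
    rewrite subsetsP inE => /eqP cardS.
    by have [/Dgood|/Dbad] := boolP (S \subset agree m1 m2); move=> -> //; auto.
  (* At most [l] disagreements leave at least [n - l] agreeing positions, enough for one successful
     set. *)
  have /card_geqP[s [s_uniq s_size s_agree]] : (n - l <= #|agree m1 m2|)%N.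
    by rewrite leq_subLR -{1}(card_agree m1 m2) addnC leq_add2r.
  have cardS : #|[set i in s]| = (n - l)%N
    by rewrite cardsE (card_uniqP s_uniq).
  exists [set i in s]; first by rewrite subsetsP inE cardS.
  by apply: Dgood cardS _; apply/subsetP => i; rewrite inE => /s_agree.
move=> r1 r2 m1 m2 m3 PHam; apply: Pr_dec_condenc_ge => // D _ Dbad.
apply/eqP/ohead_pmap_none => S; rewrite subsetsP inE => /eqP cardS.
(* A set of [n - l] agreeing positions would force the Hamming distance to be at most [l]. *)
apply: (Dbad _ cardS); apply: contra PHam => /subset_leq_card.
by rewrite cardS leq_subLR -{1}(card_agree m1 m2) addnC leq_add2r.
Qed.
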